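(* Let $(G,\mathcal{C},\mathit{color})$ be an edge-colored graph (finite, simple, undirected) of order at least $m$, where $m$ is a positive integer, and let $f$ be a mapping from $\mathcal{C}$ to the set of non-negative integers. Then $G$ has an $f$-chromatic spanning forest with exactly $m$ components if and only if \[ \omega(G-E_R(G)) \le m+\sum_{c\in R} f(c) \quad \text{for every } R\subseteq \mathcal{C} \] (including $R=\emptyset$).
   Context: An edge-colored graph $(G,\mathcal{C},\mathit{color})$ is a finite simple undirected graph $G$ together with a map $\mathit{color}:E(G)\to\mathcal{C}$, where $\mathcal{C}$ is a set of colors. For $R\subseteq\mathcal{C}$, $E_R(G)=\{e\in E(G) : \mathit{color}(e)\in R\}$ and $E_c(G)=E_{\{c\}}(G)$; $G-E_R(G)$ denotes the graph $(V(G),E(G)\setminus E_R(G))$. $\omega(H)$ denotes the number of connected components of a graph $H$. Given a mapping $f$ from $\mathcal{C}$ to the non-negative integers, an edge-colored graph (or subgraph, with the inherited coloring) $H$ is $f$-chromatic if $|E_c(H)|\le f(c)$ for every color $c\in\mathcal{C}$. *)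

(* Defs.v *)
From mathcomp Require Import all_boot all_order all_algebra.
From mathcomp Require Import boolp classical_sets reals ereal esum.

Set Implicit Arguments.
Unset Strict Implicit.
Unset Printing Implicit Defensive.

(* A finite simple undirected graph on V is a set of two-element subsets of V:
   loops and parallel edges cannot occur. *)
Record sgraph (V : finType) := SGraph {
  edges :> {set {set V}};
  edges_card2 : forall e, e \in edges -> #|e| = 2 }.

Definition adj (V : finType) (G : sgraph V) : rel V :=
  fun x y => [set x; y]%SET \in edges G.

Lemma adj_sym (V : finType) (G : sgraph V) : symmetric (adj G).
Proof. by move=> x y; rewrite /adj finset.setUC. Qed.

Lemma adj_irrefl (V : finType) (G : sgraph V) : irreflexive (adj G).
Proof.
move=> x; apply/negP => /edges_card2.
by rewrite finset.setUid cards1.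
Qed.

Definition omega (V : finType) (G : sgraph V) : nat := n_comp (adj G) V.

(* The size condition excludes the degenerate cycle x, y, x that [ucycle]
   finds along every edge. *)
Definition forest (V : finType) (G : sgraph V) : Prop :=
  forall p : seq V, 2 < size p -> ~ ucycle (adj G) p.

Lemma del_edges_card2 (V : finType) (G : sgraph V) (F : {set {set V}}) e :
  e \in (edges G :\: F)%SET -> #|e| = 2.
Proof. by rewrite finset.in_setD => /andP[_]; exact: edges_card2. Qed.

Definition del_edges (V : finType) (G : sgraph V) (F : {set {set V}}) :
  sgraph V := SGraph (@del_edges_card2 V G F).

Definition edge (V : finType) (G : sgraph V) := {e : {set V} | e \in edges G}.

(* Colorings are defined on the edges of G only, so that an edgeless graph is
   colorable even when there are no colors. *)
Definition coloring (V : finType) (G : sgraph V) (C : Type) := edge G -> C.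

Definition colored_edges (V : finType) (G : sgraph V) (C : Type)
    (color : coloring G C) (R : set C) : {set {set V}} :=
  [set val e | e : edge G & color e \in R]%SET.

Definition inherited (V : finType) (G H : sgraph V) (C : Type)
    (sHG : edges H \subset edges G) (color : coloring G C) : coloring H C :=
  fun e => color (Sub (val e) (fintype.subsetP sHG (val e) (valP e))).

Definition f_chromatic (V : finType) (G : sgraph V) (C : Type)
    (f : C -> nat) (color : coloring G C) : Prop :=
  forall c : C, #|colored_edges color [set c]%classic| <= f c.

(* A spanning subgraph of G is a graph on the same vertex type whose edges are
   edges of G. *)
Definition has_f_chromatic_spanning_forest (V : finType) (G : sgraph V)
    (C : Type) (f : C -> nat) (color : coloring G C) (m : nat) : Prop :=
  exists (H : sgraph V) (sHG : edges H \subset edges G),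
    [/\ forest H, omega H = m & f_chromatic f (inherited sHG color)].

(* The set of colors may be infinite, so the sum of f over R lives in
   [0, +oo]: it is the supremum of the finite partial sums, which is the
   ordinary sum when R is finite. *)
Definition color_sum (K : realType) (C : choiceType) (f : C -> nat)
    (R : set C) : \bar K :=
  (\esum_(c in R) ((f c)%:R)%:E)%R.

(* Main.v *)
(* With c(A) the number of components of (V, A), minus c is the graphic matroid
   rank up to a constant, and the condition is Rado's condition for an
   independent set of rank |V| - m meeting color class i in at most f(i) edges.
   Take an edge set E minimal for the condition and suppose that a color i has
   more than f(i) edges in E.  Deleting an edge e of color i breaks the
   condition, so some set of colors R avoiding i is tight, and e is a bridge of
   E without the colors of R.  Tight sets are closed under union by
   submodularity, so one tight R serves for all edges of color i; adding i to R
   then increases c by more than f(i), a contradiction.  Hence E is f-chromatic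
   with c(E) <= m, and a minimal subset of E with c <= m is the forest. *)
Require Import Defs.
From mathcomp Require Import all_boot zify.

Set Implicit Arguments.
Unset Strict Implicit.
Unset Printing Implicit Defensive.

(** * Corank functions of matroids *)

(* [c A] is a constant minus the rank of [A] in a matroid, and [d A e] says
   that [e] is spanned by [A]. *)
Definition corank (T : finType) (c : {set T} -> nat) (d : {set T} -> pred T) :=
  (forall A e, c A = c (e |: A) + ~~ d A e) /\
  (forall A B : {set T}, A \subset B -> subpred (d A) (d B)).

(** Whatever a set spans, a larger set spans too, so adding [X] lowers [c] over [S'] by no more than
    over a subset [S]. Induction on [#|X|] adds one element at a time. *)
Lemma corank_supermodular (T : finType) (c : {set T} -> nat) d (A B : {set T}) :
  corank c d -> c A + c B <= c (A :|: B) + c (A :&: B).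
Proof.
move=> [cE dS].
suff H n (X S S' : {set T}) : #|X| = n -> S \subset S' ->
    c S' + c (X :|: S) <= c (X :|: S') + c S.
  have := H _ A (A :&: B) B erefl (subsetIr _ _).
  by rewrite setUIr setUid (setIidPl (subsetUl _ _)) addnC.
elim: n X => [|n IHn] X.
  by move=> /cards0_eq -> _; rewrite !set0U.
move=> cX sS; have /card_gt0P[e eX] : 0 < #|X| by rewrite cX.
have cXe : #|X :\ e| = n by move: cX; rewrite (cardsD1 e) eX => -[].
have := IHn _ cXe sS.
rewrite (cE (X :\ e :|: S) e) (cE (X :\ e :|: S') e) !setUA !setD1K //.
have : d (X :\ e :|: S) e ==> d (X :\ e :|: S') e.
  by apply/implyP; apply: dS; rewrite setUS.
by case: (d _ e) (d _ e) => [] [] //= _; lia.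
Qed.

Lemma corank_setD_le (T : finType) (c : {set T} -> nat) d (A B : {set T}) :
  corank c d -> c (A :\: B) <= c A + #|B|.
Proof.
move=> [cE _]; have [n] := ubnP #|B|; elim: n B => // n IHn B.
have [->|[e eB]] := set_0Vmem B; first by rewrite setD0 cards0 addn0.
rewrite (cardsD1 e) eB !add1n ltnS => /IHn le1.
have := cE (A :\: B) e.
have [eA|eA] := boolP (e \in A).
  have -> : e |: A :\: B = A :\: (B :\ e).
    by apply/setP => x; rewrite !inE; case: eqP => // ->; rewrite eA eB.
  by case: (d _ _) => /=; lia.
suff -> : A :\: B = A :\: (B :\ e) by lia.
by apply/setP => x; rewrite !inE; case: eqP => // ->; rewrite (negPf eA) andbF.
Qed.

(** An element that [A :\ e] does not span is not spanned by any smaller set either, so each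
    successive deletion costs exactly one. *)
Lemma corank_setD_coloops (T : finType) (c : {set T} -> nat) d (A B : {set T}) :
  corank c d -> B \subset A -> {in B, forall e, ~~ d (A :\ e) e} ->
  c (A :\: B) = c A + #|B|.
Proof.
move=> [cE dS]; have [n] := ubnP #|B|; elim: n B => // n IHn B.
have [->|[e eB]] := set_0Vmem B; first by rewrite setD0 cards0 addn0.
rewrite (cardsD1 e) eB !add1n ltnS => leBn sBA Bd.
have eA := fintype.subsetP sBA e eB.
have -> : c (A :\: B) = c (A :\: (B :\ e)) + 1.
  rewrite (cE _ e); congr (c _ + _).
    by apply/setP => x; rewrite !inE; case: eqP => // ->; rewrite eA eB.
  suff /negPf -> : ~~ d (A :\: B) e by [].
  by apply: contra (Bd _ eB); apply: dS; rewrite setDS // sub1set.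
rewrite IHn ?addn1 ?addnS //; first exact: subset_trans (subD1set _ _) sBA.
by move=> x /setD1P[_ /Bd].
Qed.

Lemma corank_D1 (T : finType) (c : {set T} -> nat) d (A : {set T}) e :
  corank c d -> e \in A -> c (A :\ e) = c A + ~~ d (A :\ e) e.
Proof. by move=> [cE _] eA; rewrite (cE _ e) setD1K. Qed.

(** * Rado's theorem with capacities *)

Definition rado_condition (T D : finType) (c : {set T} -> nat) (col : T -> D)
    (f : D -> nat) (m : nat) (E : {set T}) : bool :=
  [forall R : {set D},
    c [set e in E | col e \notin R] <= m + \sum_(i in R) f i].

Lemma rado_condition_minimal (T D : finType) (c : {set T} -> nat) d
    (col : T -> D) (f : D -> nat) (m : nat) (E : {set T}) :
  corank c d -> minset (rado_condition c col f m) E ->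
  forall i, #|[set e in E | col e == i]| <= f i.
Proof.
move=> cd /minsetP[/forallP radoE minE] i; rewrite leqNgt; apply/negP => lt_f.
pose N (R : {set D}) := [set e in E | col e \notin R].
pose g (R : {set D}) := \sum_(j in R) f j.
have gUI R S : g (R :|: S) + g (R :&: S) = g R + g S.
  rewrite /g [in X in X = _]big_mkcond [X in _ + X = _]big_mkcond.
  rewrite [in X in _ = X]big_mkcond [X in _ = _ + X]big_mkcond -!big_split /=.
  by apply: eq_bigr => x _; rewrite !inE; do 2!case: (_ \in _); rewrite ?addn0.
pose tight (R : {set D}) := (i \notin R) && (c (N R) == m + g R).
have tightU R S : tight R -> tight S -> tight (R :|: S).
  move=> /andP[iR /eqP tR] /andP[iS /eqP tS].
  rewrite /tight !inE negb_or iR iS /= eqn_leq radoE /=.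
  (* [c] is supermodular and [g] modular; the condition at [R :&: S] then leaves only equality at
     [R :|: S]. *)
  have := corank_supermodular (N R) (N S) cd.
  have -> : N R :|: N S = N (R :&: S).
    by apply/setP => x; rewrite !inE -andb_orr negb_and.
  have -> : N R :&: N S = N (R :|: S).
    by apply/setP => x; rewrite !inE negb_or; case: (x \in E).
  have := radoE (R :&: S); have := gUI R S; rewrite -/(N _) -/(g _); lia.
have criticalP e : e \in E -> col e = i ->
    exists2 R, tight R & ~~ d (N R :\ e) e.
  move=> eE ei; have [|] := boolP (rado_condition c col f m (E :\ e)).
    move=> /minE /(_ (subD1set _ _)) /setP/(_ e).
    by rewrite !inE eqxx eE.
  case/forallPn => R; rewrite -ltnNge => ltc.
  (* If [R] contains [i], then [N R] already omits [e], and deleting [e] cannot break the condition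
     at [R]. *)
  have iR : i \notin R.
    apply: contraL ltc => iR; rewrite -leqNgt; apply: leq_trans (radoE R).
    rewrite leq_eqVlt; apply/orP; left; apply/eqP; congr (c _).
    apply/setP => x; rewrite !inE; case: eqP => //= ->.
    by rewrite ei iR andbF.
  have NeE : [set x in E :\ e | col x \notin R] = N R :\ e.
    by apply/setP => x; rewrite !inE andbA.
  have eN : e \in N R by rewrite !inE eE ei iR.
  move: ltc; rewrite NeE (corank_D1 cd eN) => ltc.
  have := radoE R; rewrite -/(N R) -/(g R) => leE.
  (* One deletion raises [c] by at most one, so failure after it means equality before it, with [e]
     unspanned. *)
  have ltg : m + g R < c (N R) + ~~ d (N R :\ e) e by [].
  exists R; rewrite /tight ?iR ?eqn_leq ?leE /=; move: ltg;
    by case: (d _ _) => /=; lia.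
have [e0] : exists e0, e0 \in [set e in E | col e == i].
  by apply/card_gt0P; apply: leq_ltn_trans lt_f.
rewrite inE => /andP[e0E /eqP e0i]; have [R0 tR0 _] := criticalP _ e0E e0i.
have [R /maxsetP[tR maxR] _] := maxset_exists tR0.
have coloop : {in [set e in E | col e == i], forall e, ~~ d (N R :\ e) e}.
  move=> e; rewrite inE => /andP[eE /eqP ei].
  have [S tS] := criticalP _ eE ei; apply: contra; apply: cd.2.
  (* Maximality puts [S] inside [R], hence [N R] inside [N S]. *)
  apply: setSD; rewrite -(maxR _ (tightU _ _ tR tS) (subsetUl _ _)).
  by apply/subsetP => x; rewrite !inE negb_or => /and3P[-> _ ->].
move: tR => /andP[iR /eqP tR].
have := radoE (i |: R); rewrite big_setU1 //= -/(g R) leqNgt => /negP; apply.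
have -> : [set e in E | col e \notin i |: R] =
    N R :\: [set e in E | col e == i].
  by apply/setP => x; rewrite !inE negb_or; case: (x \in E); rewrite ?andbF.
rewrite (corank_setD_coloops cd) // ?tR.
  by rewrite -addnA ltn_add2l addnC ltn_add2l.
apply/subsetP => x; rewrite !inE => /andP[-> /eqP ->]; exact: iR.
Qed.

(* Rado's theorem on independent transversals, with a capacity for each color
   class and a target rank below the full one. *)
Lemma corank_rado (T D : finType) (c : {set T} -> nat) d (col : T -> D)
    (f : D -> nat) (m : nat) :
  corank c d -> m <= c finset.set0 ->
  (forall R : {set D},
     c [set e | col e \notin R] <= m + \sum_(i in R) f i) ->
  exists F : {set T}, [/\ c F = m, {in F, forall e, ~~ d (F :\ e) e}
    & forall i, #|[set e in F | col e == i]| <= f i].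
Proof.
move=> cd m_le rado.
have [|E minE _] := @minset_exists _ (rado_condition c col f m) setT.
  apply/forallP => R; apply: leq_trans (rado R); rewrite leq_eqVlt.
  by apply/orP; left; apply/eqP; congr (c _); apply/setP => x; rewrite !inE.
have boundE := rado_condition_minimal cd minE.
have cE : c E <= m.
  case/minsetP: minE => /forallP/(_ finset.set0); rewrite big_set0 addn0 => + _.
  by congr (c _ <= _); apply/setP => x; rewrite !inE andbT.
have [F /minsetP[/= cF minF] sFE] := @minset_exists _ (fun F => c F <= m) _ cE.
(* If [c F < m], then [F] is nonempty because [m <= c set0], and dropping one element keeps [c] at
   most [m], against minimality. *)
have cFm : c F = m.
  apply/eqP; rewrite eqn_leq cF leqNgt; apply/negP => ltF.
  have [F0|[e eF]] := set_0Vmem F; first by move: m_le ltF; rewrite F0; lia.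
  have /setP/(_ e) : F :\ e = F.
    apply: minF; last exact: subD1set.
    by rewrite /= (corank_D1 cd eF); case: (d _ _) => /=; lia.
  by rewrite !inE eqxx eF.
exists F; split=> // [e eF|i].
  (* A spanned element could be dropped without changing [c]. *)
  apply/negP => de; have /setP/(_ e) : F :\ e = F.
    by apply: minF; rewrite ?subD1set //= (corank_D1 cd eF) de addn0.
  by rewrite !inE eqxx eF.
apply: leq_trans (boundE i); apply: subset_leq_card; apply/subsetP => x.
by rewrite !inE => /andP[/(fintype.subsetP sFE) -> ->].
Qed.

(** * Component counts and the graphic matroid *)

Definition set_adj (V : finType) (A : {set {set V}}) : rel V :=
  fun x y => [set x; y] \in A.

Lemma set_adj_connect_sym (V : finType) (A : {set {set V}}) :
  connect_sym (set_adj A).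
Proof. by apply: sym_connect_sym => x y; rewrite /set_adj finset.setUC. Qed.

Lemma connect_set_adjS (V : finType) (A B : {set {set V}}) :
  A \subset B -> subrel (connect (set_adj A)) (connect (set_adj B)).
Proof.
move=> sAB; apply: connect_sub => x y xy; apply: connect1.
exact: (fintype.subsetP sAB).
Qed.

Lemma eq_set2 (T : finType) (a b x y : T) :
  [set a; b] = [set x; y] -> (a = x /\ b = y) \/ (a = y /\ b = x).
Proof.
move=> /setP E; have := E a; have := E b; have := E x; have := E y.
rewrite !inE !eqxx ?orbT /=.
move=> /orP[] /eqP ? /orP[] /eqP ? /esym /orP[] /eqP ? /esym /orP[] /eqP ?;
  by subst; auto.
Qed.

(** Induction on the walk from its end: two crossings of the new edge can always be shortened to at
    most one. *)
Lemma connect_set_adjU1 (V : finType) (A : {set {set V}}) x y u v :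
  connect (set_adj ([set x; y] |: A)) u v ->
  [|| connect (set_adj A) u v,
      connect (set_adj A) u x && connect (set_adj A) y v
    | connect (set_adj A) u y && connect (set_adj A) x v].
Proof.
set B := _ |: A.
move=> /connectP[p]; elim/last_ind: p v => [|p w IHp] v /=.
  by move=> _ ->; rewrite connect0.
rewrite rcons_path last_rcons => /andP[up lw] ->.
have := IHp _ up erefl; move: lw; set l := last u p => lw.
have sA := set_adj_connect_sym A.
move: lw; rewrite /set_adj in_setU1 => /orP[/eqP lw|lw]; last first.
  have lw' : connect (set_adj A) l w by apply: connect1.
  by rewrite -!(same_connect_r sA lw').
have [[-> ->]|[-> ->]] := eq_set2 lw.
all: rewrite !connect0 !andbT.
all: by case: (connect _ u x) (connect _ u y) => [] [] //=; rewrite ?orbT.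
Qed.

Lemma n_comp_setT (V : finType) (e : rel V) : n_comp e V = #|roots e|.
Proof. by apply: eq_card => x; rewrite !inE andbT. Qed.

Lemma n_comp_set_adjU1 (V : finType) (A : {set {set V}}) x y :
  n_comp (set_adj A) V =
  n_comp (set_adj ([set x; y] |: A)) V + ~~ connect (set_adj A) x y.
Proof.
set B := _ |: A.
have sA := set_adj_connect_sym A; have sB := set_adj_connect_sym B.
have sAB : subrel (connect (set_adj A)) (connect (set_adj B)).
  by apply: connect_set_adjS; apply: subsetUr.
have Bxy : connect (set_adj B) x y.
  by apply: connect1; rewrite /set_adj in_setU1 eqxx.
have [Axy|nAxy] /= := boolP (connect _ x y).
  rewrite addn0; apply: eq_n_comp => u v; apply/idP/idP; first exact: sAB.
  have yx : connect (set_adj A) y x by rewrite sA.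
  case/connect_set_adjU1/or3P => [//|/andP[ux yv]|/andP[uy xv]].
    exact: connect_trans ux (connect_trans Axy yv).
  exact: connect_trans uy (connect_trans yx xv).
rewrite !n_comp_setT addn1.
(* The roots of [A] other than that of [y] correspond bijectively to the roots of [B] under
   [root (set_adj B)]. *)
pose ry := root (set_adj A) y.
have ryA : roots (set_adj A) ry by apply: roots_root.
rewrite (cardD1 ry) [ry \in _]ryA add1n; congr _.+1.
have injr : {in [predD1 roots (set_adj A) & ry] &,
    injective (root (set_adj B))}.
  move=> u v /andP[/= uy /eqP ru] /andP[/= vy /eqP rv] /(rootP sB).
  have Ny w : root (set_adj A) w = w -> w != ry -> ~~ connect (set_adj A) w y.
    by move=> rw; rewrite -(root_connect sA) rw.
  case/connect_set_adjU1/or3P => [/(rootP sA)||]; first by rewrite ru rv.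
    by case/andP=> _; rewrite sA (negPf (Ny _ rv vy)).
  by rewrite (negPf (Ny _ ru uy)).
rewrite -(card_in_image injr); apply: eq_card => z; apply/imageP/idP.
  by case=> u _ ->; apply: roots_root.
(* When [z] lies in the [A]-component of [y], the excluded root [ry] is replaced by the [A]-root of
   [x]. *)
move=> /eqP rz; have [ry_z|ry_z] := eqVneq (root (set_adj A) z) ry.
  exists (root (set_adj A) x).
    rewrite !inE roots_root // andbT.
    by apply: contra nAxy => /eqP /(rootP sA).
  rewrite -{1}rz; apply/(rootP sB).
  apply: connect_trans (sAB _ _ (connect_root _ x)).
  rewrite sB; apply: connect_trans Bxy _; rewrite sB; apply: sAB.
  by apply/(rootP sA).
exists (root (set_adj A) z); first by rewrite !inE roots_root // ry_z.
by rewrite -{1}rz; apply/(rootP sB)/sAB/connect_root.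
Qed.

Lemma n_comp_set_adj0 (V : finType) :
  n_comp (set_adj (finset.set0 : {set {set V}})) V = #|V|.
Proof.
rewrite n_comp_setT; apply: eq_card => x; rewrite inE.
apply/eqP; have := connect_root (set_adj (finset.set0 : {set {set V}})) x.
by case/connectP => -[|y p] //=; rewrite /set_adj finset.in_set0.
Qed.

(** The rest of the cycle joins the ends of its first edge. *)
Lemma ucycle_set_adj_connect (V : finType) (A : {set {set V}}) (p : seq V) :
  2 < size p -> ucycle (set_adj A) p ->
  exists x y, [set x; y] \in A /\
    connect (set_adj (A :\ [set x; y])) x y.
Proof.
case: p => [|x [|y [|z q]]] // _ /andP[].
rewrite /cycle rcons_cons [path _ _ _]/=.
move=> /andP[xy yqx] /andP[xNq /andP[yNq _]].
exists y, x; rewrite finset.setUC; split=> //.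
apply/connectP; exists (rcons (z :: q) x); last by rewrite last_rcons.
have /andP[yq lx] :
    path (set_adj A) y (z :: q) && set_adj A (last y (z :: q)) x.
  by rewrite -rcons_path.
(* The closing step into [x] could be the removed edge only if it left from [y], but it leaves from
   a vertex of [z :: q]. The earlier steps avoid [x]. *)
rewrite rcons_path; apply/andP; split; last first.
  rewrite /set_adj in_setD1; apply/andP; split; last exact: lx.
  apply: contraNneq yNq => E; have : y \in [set x; y] by rewrite set22.
  rewrite -E => /set2P[->|yx]; first exact: (mem_last z q).
  by move: xNq; rewrite yx inE eqxx.
have allN : all [pred v | v != x] (y :: z :: q).
  by apply/allP => v vq /=; apply: contraNneq xNq => <-.
apply: sub_in_path allN yq => u v /= ux vx uv.
rewrite /set_adj in_setD1; apply/andP; split; last exact: uv.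
apply/negP => /eqP/setP/(_ x).
by rewrite !inE eqxx orTb !(eq_sym x) (negPf ux) (negPf vx).
Qed.

(** The map [root e'] sends the roots of [e] onto those of [e']. *)
Lemma leq_n_comp (V : finType) (e e' : rel V) :
  connect_sym e -> connect_sym e' -> subrel (connect e) (connect e') ->
  n_comp e' V <= n_comp e V.
Proof.
move=> sE sE' see'; rewrite !n_comp_setT.
apply: leq_trans (leq_image_card (root e') (roots e)).
apply: subset_leq_card; apply/subsetP => z /eqP rz.
apply/imageP; exists (root e z); first exact: roots_root.
by rewrite -{1}rz; apply/(rootP sE')/see'/connect_root.
Qed.

(** An edge is spanned when its ends are already connected; ranging over all [x] and [y] avoids
    choosing an order of the ends. *)
Lemma corank_n_comp (T V : finType) (g : T -> {set V}) :
  (forall t, #|g t| = 2) ->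
  corank (fun A => n_comp (set_adj (g @: A)) V)
    (fun A t => [forall x, forall y,
       (g t == [set x; y]) ==> connect (set_adj (g @: A)) x y]).
Proof.
move=> g2; split=> [A t|A B sAB t /forallP dA]; last first.
  apply/forallP => x; apply/forallP => y; apply/implyP => txy.
  have /forallP/(_ y)/implyP/(_ txy) := dA x.
  exact/connect_set_adjS/imsetS.
have /eqP/cards2P[x [y [_ txy]]] := g2 t.
rewrite imsetU1 txy (n_comp_set_adjU1 _ x y); congr (_ + ~~ _).
apply/idP/forallP => [Axy u|/(_ x)/forallP/(_ y)/implyP]; last exact.
apply/forallP => v; apply/implyP => /eqP.
by case/eq_set2 => [[<- <-]//|[<- <-]]; rewrite set_adj_connect_sym.
Qed.

(** * Edge sets of a graph and its spanning subgraphs *)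

Lemma omegaE (V : finType) (G : sgraph V) :
  omega G = n_comp (set_adj (edges G)) V.
Proof. by []. Qed.

Lemma edges_imset (V : finType) (G : sgraph V) :
  edges G = val @: [set: edge G].
Proof.
apply/setP => e; apply/idP/imsetP => [eG|[t _ ->]]; last exact: valP.
by exists (Sub e eG).
Qed.

Definition edge_omega (V : finType) (G : sgraph V) (A : {set edge G}) : nat :=
  n_comp (set_adj (val @: A)) V.

Definition spanned (V : finType) (G : sgraph V) (A : {set edge G}) :
    pred (edge G) :=
  fun e => [forall x, forall y,
    (val e == [set x; y]) ==> connect (set_adj (val @: A)) x y].

Lemma corank_edge_omega (V : finType) (G : sgraph V) :
  corank (@edge_omega V G) (@spanned V G).
Proof. exact: corank_n_comp (fun e : edge G => edges_card2 (valP e)). Qed.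

Lemma omega_del_edges (V : finType) (G : sgraph V) (F : {set edge G}) :
  omega (del_edges G (val @: F)) = edge_omega (~: F).
Proof.
rewrite omegaE /edge_omega.
suff -> : edges (del_edges G (val @: F)) = val @: ~: F by [].
apply/setP => e; rewrite in_setD; apply/andP/imsetP.
  case=> eF eG; exists (Sub e eG : edge G) => //.
  by rewrite inE; apply: contra eF => tF; apply/imsetP; exists (Sub e eG).
case=> t; rewrite inE => tF ->; split; last exact: valP.
by rewrite mem_imset //; apply: val_inj.
Qed.

Lemma omega_del_edges_le (V : finType) (G : sgraph V) (F : {set edge G}) :
  omega (del_edges G (val @: F)) <= omega G + #|F|.
Proof.
rewrite omega_del_edges -setTD.
apply: leq_trans (corank_setD_le setT F (corank_edge_omega G)) _.
by rewrite /edge_omega -edges_imset.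
Qed.

Lemma leq_omega (V : finType) (G H : sgraph V) :
  edges G \subset edges H -> omega H <= omega G.
Proof.
move=> sGH; apply: leq_n_comp; try exact: set_adj_connect_sym.
exact: connect_set_adjS.
Qed.

(** A cycle has an edge whose ends are connected by other edges of [F], and such an edge is
    spanned. *)
Lemma forest_unspanned (V : finType) (G H : sgraph V) (F : {set edge G}) :
  edges H = val @: F -> {in F, forall e, ~~ spanned (F :\ e) e} -> forest H.
Proof.
move=> HE indF p p2 /(ucycle_set_adj_connect p2)[x [y []]].
rewrite HE => /imsetP[e eF exy] Cxy; have /negP[] := indF e eF.
apply/forallP => u; apply/forallP => v; apply/implyP => /eqP.
have sub : val @: F :\ val e \subset val @: (F :\ e).
  apply/subsetP => t' /setD1P[ne /imsetP[t tF Dt]]; rewrite Dt imset_f //.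
  by rewrite !inE tF andbT; apply: contraNneq ne => <-; rewrite Dt.
rewrite -exy => /eq_set2 [] [<- <-]; last rewrite set_adj_connect_sym.
all: by apply: (connect_set_adjS sub); rewrite -exy.
Qed.

(* Sums over possibly infinite color sets, and the equivalence *)
From mathcomp Require Import all_order all_algebra.
From mathcomp Require Import boolp classical_sets functions cardinality fsbigop.
From mathcomp Require Import reals ereal esum.
Import Order.TTheory GRing.Theory Num.Theory.

Lemma color_sum_ge_seq (K : realType) (C : choiceType) (f : C -> nat)
    (R : set C) (s : seq C) :
  uniq s -> (forall c, c \in s -> R c) ->
  ((((\sum_(c <- s) f c)%N)%:R)%:E <= color_sum K f R)%E%R.
Proof.
move=> Us sR; apply: esum_ge; exists [set` s]%classic.
  by split; [exact: finite_seq | exact: sR].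
by rewrite -fsbig_seq // sumEFin natr_sum.
Qed.

Lemma color_sum_seq (K : realType) (C : choiceType) (f : C -> nat) (s : seq C) :
  uniq s ->
  color_sum K f [set` s]%classic = (((\sum_(c <- s) f c)%N)%:R)%:E%R.
Proof.
move=> Us; rewrite /color_sum esum_fset.
- by rewrite -fsbig_seq // sumEFin natr_sum.
- exact: finite_seq.
- by move=> c _; rewrite lee_fin ler0n.
Qed.

Lemma colored_edgesE (V : finType) (G : sgraph V) (C : Type)
    (color : coloring G C) (R : set C) :
  colored_edges color R = (val @: [set e | color e \in R])%SET.
Proof.
by apply/setP => e; apply/imsetP/imsetP => -[t tR ->]; exists t;
  move: tR; rewrite ?inE.
Qed.

(** Only finitely many colors occur on edges, and their finite sum is a lower bound for
    [color_sum]. *)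
Lemma card_colored_edges_le (V : finType) (G : sgraph V) (C : choiceType)
    (f : C -> nat) (color : coloring G C) (R : set C) (K : realType) :
  f_chromatic f color ->
  (((#|[set e | color e \in R]%SET|)%:R)%:E <= color_sum K f R)%E%R.
Proof.
move=> fcol; pose s := undup [seq color e | e in [set e | color e \in R]%SET].
have sR c : c \in s -> R c.
  rewrite mem_undup => /mapP[e]; rewrite mem_enum finset.inE => /set_mem Re ->.
  exact: Re.
apply: le_trans (color_sum_ge_seq K f (undup_uniq _) sR).
rewrite lee_fin ler_nat.
(* Double counting: the color of each such edge occurs exactly once in the duplicate-free [s]. *)
have -> : #|[set e | color e \in R]%SET| =
    (\sum_(e | color e \in R) \sum_(c <- s) (color e == c)%N)%N.
  rewrite -sum1_card; apply: eq_big => [e|e Re]; first by rewrite !inE.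
  have <- : count_mem (color e) s = 1%N.
    rewrite count_uniq_mem ?undup_uniq // mem_undup.
    by rewrite fintype.image_f // finset.inE.
  rewrite -sum1_count big_mkcond; apply: eq_bigr => c _ /=.
  by rewrite eq_sym; case: eqP.
rewrite exchange_big /=; apply: leq_sum => c _; apply: leq_trans (fcol c).
rewrite colored_edgesE card_imset; last exact: val_inj.
rewrite -sum1_card big_mkcond [leqRHS]big_mkcond; apply: leq_sum => e _ /=.
by rewrite inE in_set1; case: (_ \in R) => //; case: eqP.
Qed.

Theorem theorem9 (K : realType) (V : finType) (G : sgraph V)
    (C : choiceType) (color : coloring G C) (m : nat) (f : C -> nat)
    (m_gt0 : (0 < m)%N) (order_ge_m : (m <= #|V|)%N) :
  has_f_chromatic_spanning_forest f color m <->
  (forall R : set C,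
     (((omega (del_edges G (colored_edges color R)))%:R)%:E
        <= (m%:R)%:E + color_sum K f R)%E).
Proof.
split=> [[H [sHG [_ <- fH]]] R|cond].
  (* [H] without its edges colored in [R] lies inside [G] without the colors of [R]. Each edge so
     deleted from [H] adds at most one component, and [fH] bounds their number. *)
  apply: le_trans (leeD2l _ (card_colored_edges_le R K fH)).
  rewrite -EFinD lee_fin -natrD ler_nat.
  apply: leq_trans (omega_del_edges_le _); rewrite -colored_edgesE.
  apply: leq_omega; apply/fintype.subsetP => e.
  rewrite !finset.in_setD => /andP[eR eH].
  rewrite (fintype.subsetP sHG) // andbT.
  apply: contra eR; rewrite !colored_edgesE => /imsetP[t tR Dt].
  apply/imsetP; exists (Sub e eH); last by [].
  rewrite finset.in_set /inherited; move: tR; rewrite finset.in_set.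
  by congr (color _ \in R); apply: val_inj.
(* Restricting to the colors that occur in [G] gives the finite type that [corank_rado] requires. *)
pose col (e : edge G) : seq_sub (codom color) := SeqSub (codom_f color e).
(* The order hypothesis enters here: the edgeless graph has [#|V|] components. *)
have indep0 : m <= edge_omega (G := G) finset.set0.
  by rewrite /edge_omega imset0 n_comp_set_adj0.
have [R|F [cF indF boundF]] :=
    @corank_rado _ _ _ _ col (fun i => f (val i)) m
      (corank_edge_omega G) indep0.
  (* The condition is taken at a finite set of colors, where the extended sum is an ordinary one. *)
  pose s := [seq val i | i <- enum R].
  have Us : uniq s by rewrite map_inj_uniq ?enum_uniq //; apply: val_inj.
  have := cond [set` s]%classic.
  rewrite color_sum_seq // -EFinD lee_fin -natrD ler_nat colored_edgesE.
  rewrite omega_del_edges big_map big_enum; congr (edge_omega _ <= _).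
  apply/setP => e; rewrite !inE; congr negb.
  by rewrite mem_setE -[color e]/(val (col e)) mem_map ?mem_enum //;
    apply: val_inj.
have valF2 e : e \in (val @: F)%SET -> #|e| = 2.
  by case/imsetP => t _ ->; apply: edges_card2 (valP t).
exists (SGraph valF2).
have sFG : edges (SGraph valF2) \subset edges G.
  by apply/fintype.subsetP => e /imsetP[t _ ->]; apply: valP.
exists sFG; split=> [||c].
- exact: forest_unspanned indF.
- exact: cF.
rewrite colored_edgesE card_imset; last exact: val_inj.
set A := [set e | _]%SET.
(* A color absent from the forest has an empty class; any other is the value of some [col e1], to
   which [boundF] applies. *)
have [->|[e0]] := set_0Vmem A; first by rewrite cards0.
rewrite finset.in_set => /set_mem /= e0c.
pose e1 : edge G := Sub (val e0) (fintype.subsetP sFG _ (valP e0)).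
have val1 : val (col e1) = c by exact: e0c.
rewrite -[X in f X]val1; apply: leq_trans (boundF (col e1)).
rewrite -(card_imset A val_inj); apply: leq_trans (leq_imset_card val _).
apply/subset_leq_card/fintype.subsetP => x /imsetP[e].
rewrite finset.in_set => /set_mem /= ec ->.
have /imsetP[t tF et] := valP e; rewrite et imset_f // finset.inE tF /=.
apply/eqP/val_inj; rewrite val1 -ec /=; congr color; exact: val_inj.
Qed.
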